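(* For every real $\alpha>\frac{1}{2}$ there exist an integer $N_0$ and a constant $C$ such that the following holds. Let $G$ be a simple edge-colored graph with $n\geq N_0$ vertices whose edge set is partitioned into $n$ color classes $\mathcal{F}=(F_1,\ldots,F_n)$, with $\mathcal{F}=\mathcal{F}_M\cup\mathcal{F}_T\cup\mathcal{F}_S$ where every $F_i\in\mathcal{F}_M$ is a matching of size $2$, every $F_i\in\mathcal{F}_T$ is a triangle, every $F_i\in\mathcal{F}_S$ is a single edge, and $|\mathcal{F}_M\cup\mathcal{F}_T|\geq\alpha n$. Then $G$ contains a rainbow cycle of length at most $C\log n$.
   Context: An edge-colored graph is a graph $G$ with a map $c:E(G)\to\mathbb{N}$; the color classes are the sets of edges of a given color. A cycle is rainbow if its distinct edges come from distinct color classes. A matching of size $2$ is a set of two vertex-disjoint edges; a triangle is the edge set of a $3$-cycle. Logarithms are to base $2$. *)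

(* Defs.v *)
From mathcomp Require Import all_boot all_order all_algebra.
From mathcomp Require Import reals exp.

Set Implicit Arguments.
Unset Strict Implicit.
Unset Printing Implicit Defensive.

Import Order.TTheory GRing.Theory Num.Theory.
Local Open Scope ring_scope.

Record sgraph (V : finType) := SGraph {
  adj :> rel V;
  adj_sym : symmetric adj;
  adj_irr : irreflexive adj
}.

Section EdgeColoredGraph.
Variables (V : finType) (G : sgraph V).

Definition edges : {set {set V}} :=
  [set [set xy.1; xy.2] | xy : V * V & G xy.1 xy.2].

(* Only the values of [c] on [edges] matter. *)
Variable c : {set V} -> nat.

Definition color_class (i : nat) : {set {set V}} :=
  [set e in edges | c e == i].

(* The nonempty color classes. *)
Definition color_classes : {set {set {set V}}} :=
  [set color_class (c e) | e in edges].

(* [p] lists the vertices of a cycle in cyclic order, so that the length of the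
   cycle is [size p]. *)
Definition is_cycle (p : seq V) : Prop :=
  [/\ (3 <= size p)%N, uniq p & cycle G p].

Definition cycle_edges (p : seq V) : {set {set V}} :=
  [set [set x; next p x] | x in p].

Definition rainbow (p : seq V) : Prop := {in cycle_edges p &, injective c}.

End EdgeColoredGraph.

Section ClassTypes.
Variable V : finType.

Definition is_matching2 (F : {set {set V}}) : Prop :=
  exists e f : {set V}, [/\ F = [set e; f], e != f & [disjoint e & f]].

Definition is_triangle (F : {set {set V}}) : Prop :=
  exists x y z : V, uniq [:: x; y; z] /\
    F = [set [set x; y]; [set y; z]; [set z; x]].

Definition is_single_edge (F : {set {set V}}) : Prop :=
  exists e : {set V}, F = [set e].

End ClassTypes.

Definition log2 (R : realType) (x : R) : R := ln x / ln 2.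

(* Main.v *)
Require Import Defs.
From mathcomp Require Import all_boot all_order all_algebra.
From mathcomp Require Import reals exp zify lra.

Set Implicit Arguments.
Unset Strict Implicit.
Unset Printing Implicit Defensive.

Import Order.TTheory GRing.Theory Num.Theory.

(** Call a color class avoidable if every vertex is missed by one of its edges, as
    matchings of size 2 and triangles are.  The single-edge classes cover at most
    [2(1 - alpha)n] vertices and the vertex sets of the classes have linear total size,
    so linearly many vertices of bounded degree meet no single-edge class.  Among them a
    maximal set [J] of vertices, no two of which meet a common class, still has linear
    size.  Every class has an edge avoiding [J].  Selecting one such edge per class gives
    [n] edges of distinct colors on only [n - #|J|] vertices, that is, at least
    [1 + 1/k] edges per vertex for a constant [k].

    In a vertex-minimal subgraph of that density every vertex set [S] touches at least
    [(1 + 1/k)#|S|] edges.  As long as the edges touching the ball of radius [r] around a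
    vertex belong to a tree spanning the ball of radius [r + 1], the latter therefore has
    at least [1 + 1/k] times as many vertices as the former, so a cycle appears at some
    radius [O(log n)]. *)

Lemma leq_expn_linear k r : k ^ r * (k + r) <= k.+1 ^ r * k.
Proof.
elim: r => [|r IHr]; first by rewrite !expn0 addn0.
rewrite !expnS; move: (k ^ r) (k.+1 ^ r) IHr => p q IHr.
have : k.+1 * (p * (k + r)) <= k.+1 * (q * k) by rewrite leq_mul.
nia.
Qed.

Lemma leq_double_expn k : 0 < k -> 2 * k ^ k <= k.+1 ^ k.
Proof.
move=> k_gt0; rewrite -(leq_pmul2r k_gt0) -mulnA mulnCA mul2n -addnn.
exact: leq_expn_linear.
Qed.

Lemma ltn_expn_trunc_log k n : 0 < k ->
  k ^ (k * (trunc_log 2 n).+1) * n < k.+1 ^ (k * (trunc_log 2 n).+1).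
Proof.
move=> k_gt0; set t := (trunc_log 2 n).+1.
have n_lt : n < 2 ^ t by apply: trunc_log_ltn.
apply: (@leq_trans ((2 * k ^ k) ^ t)); last by rewrite expnM leq_exp2r // leq_double_expn.
by rewrite expnM expnMn mulnC ltn_pmul2r // !expn_gt0 k_gt0.
Qed.

Section ShortCycles.
Variable V : finType.
Implicit Types (E T : {set {set V}}) (B S W X e : {set V}) (x y v : V).

Definition link E : rel V := fun x y => [set x; y] \in E.

Definition walk_within E r x y : Prop :=
  exists p, [/\ path (link E) x p, last x p = y & size p <= r].

Definition has_cycle_within E m : Prop :=
  exists p, [/\ 3 <= size p, uniq p, cycle (link E) p & size p <= m].

Definition incident E S : {set {set V}} := [set e in E | ~~ [disjoint e & S]].

Definition neighborhood E B : {set V} := [set y | [exists x in B, link E x y]].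

Definition ball E v r : {set V} := iter r (fun B => B :|: neighborhood E B) [set v].

Lemma link_sym E : symmetric (link E).
Proof. by move=> x y; rewrite /link setUC. Qed.

Lemma link_sub E T : T \subset E -> subrel (link T) (link E).
Proof. by move=> /subsetP sTE x y /sTE. Qed.

Lemma walk_within_sub E T r x y :
  T \subset E -> walk_within T r x y -> walk_within E r x y.
Proof.
move=> sTE [p [Tp lastp sizep]]; exists p; split => //.
exact: sub_path (link_sub sTE) _ _ Tp.
Qed.

Lemma walk_within_leq E r s x y :
  r <= s -> walk_within E r x y -> walk_within E s x y.
Proof. by move=> rs [p [Ep lastp sizep]]; exists p; split => //; apply: leq_trans rs. Qed.

Lemma walk_within_link E x y : link E x y -> walk_within E 1 x y.
Proof. by move=> Exy; exists [:: y]; rewrite /= Exy. Qed.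

Lemma walk_within_sym E r x y : walk_within E r x y -> walk_within E r y x.
Proof.
case=> p [Ep <- sizep]; exists (rev (belast x p)).
rewrite size_rev size_belast rev_path; split => //.
  by rewrite (eq_path (e' := link E)) // => u v; rewrite link_sym.
by case: p {Ep sizep} => //= y' p; rewrite rev_cons last_rcons.
Qed.

Lemma walk_within_trans E r s x y z :
  walk_within E r x y -> walk_within E s y z -> walk_within E (r + s) x z.
Proof.
move=> [p [Ep lastp sizep]] [q [Eq lastq sizeq]]; exists (p ++ q).
by rewrite cat_path last_cat lastp size_cat Ep leq_add.
Qed.

Lemma has_cycle_within_sub E T m :
  T \subset E -> has_cycle_within T m -> has_cycle_within E m.
Proof.
move=> sTE [p [p3 p_uniq Tp sizep]]; exists p; split => //.
exact: sub_cycle (link_sub sTE) _ Tp.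
Qed.

Lemma has_cycle_within_leq E m n :
  m <= n -> has_cycle_within E m -> has_cycle_within E n.
Proof.
by move=> mn [p [p3 p_uniq Ep sizep]]; exists p; split => //; apply: leq_trans mn.
Qed.

Lemma has_cycle_within_chord E T m x y :
  T \subset E -> walk_within T m x y -> x != y -> [set x; y] \in E :\: T ->
  has_cycle_within E m.+1.
Proof.
move=> sTE [p [Tp lastp sizep]] neq_xy /setDP[Exy nTxy].
case/shortenP: Tp lastp => q Tq q_uniq sub_qp lastq.
have size_qp : size q <= size p by apply: uniq_leq_size => //; case/andP: q_uniq.
exists (x :: q); split => //; last by rewrite /= ltnS (leq_trans size_qp).
  case: q Tq lastq {q_uniq sub_qp size_qp} => [_ /= eq_xy|z [|//]] /=.
    by rewrite eq_xy eqxx in neq_xy.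
  by rewrite andbT /link => /[swap] ->; rewrite (negbTE nTxy).
by rewrite /= rcons_path (sub_path (link_sub sTE) Tq) lastq /= link_sym.
Qed.

Lemma neighborhoodP E B y :
  reflect (exists2 x, x \in B & link E x y) (y \in neighborhood E B).
Proof. by rewrite inE; apply: exists_inP. Qed.

Lemma ball_spanning_tree E v r :
  exists T, [/\ T \subset E, #|T| < #|ball E v r| &
    {in ball E v r, forall x, walk_within T r v x}].
Proof.
elim: r => [|r [T [sTE ltT walkT]]].
  exists set0; split; rewrite ?sub0set ?cards0 ?cards1 //.
  by move=> x /set1P->; exists [::].
rewrite [ball E v r.+1]/=; set B := ball E v r in ltT walkT *.
pose N := neighborhood E B :\: B.
have -> : B :|: neighborhood E B = B :|: N.
  by apply/setP => x; rewrite !inE; case: (x \in B).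
pose parent y := odflt y [pick x in B | link E x y].
have parentP y : y \in N -> parent y \in B /\ link E (parent y) y.
  case/setDP=> /neighborhoodP[x xB Exy] _; rewrite /parent.
  by case: pickP => [z /andP[]|/(_ x)] //; rewrite xB Exy.
pose newT := [set [set parent y; y] | y in N].
exists (T :|: newT); split.
- rewrite subUset sTE; apply/subsetP => _ /imsetP[y /parentP[_ Ey] ->]; exact: Ey.
- have -> : #|B :|: N| = #|B| + #|N|.
    rewrite cardsU (_ : B :&: N = set0) ?cards0 ?subn0 //.
    by rewrite setIDA setIC setDIl setDv setI0.
  rewrite (leq_ltn_trans (leq_card_setU _ _)) // -addSn leq_add //.
  exact: leq_imset_card.
- move=> x /setUP[xB|xN].
    exact/(walk_within_leq (leqnSn r))/(walk_within_sub (subsetUl _ _))/walkT.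
  have [pB _] := parentP _ xN; rewrite -addn1.
  apply: walk_within_trans (walk_within_sub (subsetUl _ _) (walkT _ pB)) _.
  by apply/walk_within_link/setUP; right; apply/imsetP; exists x.
Qed.

Lemma incident_ball_ends E v r e :
  {in E, forall e, #|e| = 2} -> e \in incident E (ball E v r) ->
  exists x y, [/\ e = [set x; y], x != y, x \in ball E v r.+1 & y \in ball E v r.+1].
Proof.
move=> card2E; rewrite inE => /andP[eE /pred0Pn[x /andP[/= xe xB]]].
have [y neq_xy def_e] : exists2 y, x != y & e = [set x; y].
  have /eqP/cards2P[a [b [neq_ab def_e]]] := card2E _ eE.
  move: xe; rewrite {1}def_e => /set2P[] ->; first by exists b.
  by exists a; rewrite 1?eq_sym // setUC.
exists x, y; split => //; rewrite inE ?xB //.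
by apply/orP; right; apply/neighborhoodP; exists x; rewrite // /link -def_e.
Qed.

Lemma card_incident_ball E v r : {in E, forall e, #|e| = 2} ->
  #|incident E (ball E v r)| < #|ball E v r.+1| \/ has_cycle_within E (2 * r.+1).+1.
Proof.
move=> card2E; have [T [sTE ltT walkT]] := ball_spanning_tree E v r.+1.
have [/subset_leq_card leT|] := boolP (incident E (ball E v r) \subset T).
  by left; apply: leq_ltn_trans ltT.
case/subsetPn => e inc_e nTe; right.
have [x [y [def_e neq_xy xB yB]]] := incident_ball_ends card2E inc_e.
move: inc_e nTe; rewrite {e}def_e => /setIdP[Exy _] nTxy.
apply: (has_cycle_within_chord sTE _ neq_xy); last by rewrite inE nTxy.
rewrite mul2n -addnn; apply: walk_within_trans (walkT _ yB).
exact/walk_within_sym/walkT.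
Qed.

Lemma ball_sub E W v r : v \in W -> E \subset powerset W -> ball E v r \subset W.
Proof.
move=> vW /subsetP sEW; elim: r => [|r IHr]; first by rewrite sub1set.
rewrite subUset IHr; apply/subsetP => y /neighborhoodP[x _ /sEW].
by rewrite powersetE subUset !sub1set => /andP[].
Qed.

Lemma leq_expn_card_ball E W v a b r :
  {in E, forall e, #|e| = 2} -> E \subset powerset W -> v \in W ->
  (forall S, S \subset W -> a * #|S| <= b * #|incident E S|) ->
  a ^ r <= b ^ r * #|ball E v r| \/ has_cycle_within E (2 * r).+1.
Proof.
move=> card2E sEW vW expansion; elim: r => [|r [IHr|cycleE]].
- by left; rewrite cards1.
- have [lt_ball|] := card_incident_ball v r card2E; last by right.
  have growth : a * #|ball E v r| <= b * #|ball E v r.+1|.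
    apply: leq_trans (expansion _ (ball_sub r vW sEW)) _.
    by rewrite leq_mul2l (ltnW lt_ball) orbT.
  left; move: growth => /(leq_mul (leqnn (b ^ r))); rewrite mulnCA !expnSr -mulnA.
  by apply: leq_trans; rewrite mulnC leq_mul.
- by right; apply: has_cycle_within_leq cycleE; lia.
Qed.

Lemma cards_incident E X S :
  #|E ::&: X| = #|E ::&: (X :\: S)| + #|incident (E ::&: X) S|.
Proof.
rewrite -(cardsID [set e : {set V} | [disjoint e & S]]); congr (_ + _).
  by apply: eq_card => e; rewrite !inE subsetD andbA.
by apply: eq_card => e; rewrite !inE andbC.
Qed.

Lemma minimal_dense_expansion E W a b :
  set0 \notin E -> W != set0 -> a * #|W| <= b * #|E ::&: W| ->
  exists X, [/\ X \subset W, X != set0 &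
    forall S, S \subset X -> a * #|S| <= b * #|incident (E ::&: X) S|].
Proof.
move=> E0 W0 denseW.
pose dense X := (X != set0) && (a * #|X| <= b * #|E ::&: X|).
have [X /minsetP[/andP[X0 denseX] minX] sXW] : {X | minset dense X & X \subset W}.
  by apply: minset_exists; rewrite /dense W0.
exists X; split => // S sSX; have [->|S0] := eqVneq S set0; first by rewrite cards0 muln0.
have cardX : #|X| = #|X :\: S| + #|S| by rewrite addnC -(cardsID S X) (setIidPr sSX).
have sparseD : b * #|E ::&: (X :\: S)| <= a * #|X :\: S|.
  have [->|D0] := eqVneq (X :\: S) set0.
    rewrite (_ : E ::&: set0 = set0) ?cards0 ?muln0 //; apply/setP => e.
    by rewrite !inE subset0; apply: contraNF E0 => /andP[+ /eqP <-].
  rewrite leqNgt; apply: contra S0 => /ltnW denseD.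
  have eqDX : X :\: S = X by apply: minX; rewrite ?subsetDl // /dense D0.
  by rewrite -cards_eq0; move: cardX; rewrite eqDX; lia.
by move: denseX; rewrite cardX (cards_incident _ _ S) !mulnDr; lia.
Qed.

Lemma dense_has_cycle E W a b r :
  {in E, forall e, #|e| = 2} -> W != set0 -> a * #|W| <= b * #|E ::&: W| ->
  b ^ r * #|W| < a ^ r -> has_cycle_within E (2 * r).+1.
Proof.
move=> card2E W0 denseW large_r.
have E0 : set0 \notin E by apply/negP => /card2E; rewrite cards0.
have [X [sXW /set0Pn[v vX] expansion]] := minimal_dense_expansion E0 W0 denseW.
have sEX : E ::&: X \subset E by apply/subsetP => e /setIdP[].
have card2X : {in E ::&: X, forall e, #|e| = 2} by move=> e /(subsetP sEX)/card2E.
have sXX : E ::&: X \subset powerset X.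
  by apply/subsetP => e /setIdP[_]; rewrite powersetE.
have [large_ball|] := leq_expn_card_ball r card2X sXX vX expansion; last first.
  exact: has_cycle_within_sub.
have : #|ball (E ::&: X) v r| <= #|W|.
  exact/subset_leq_card/(subset_trans (ball_sub r vX sXX)).
by move/(leq_mul (leqnn (b ^ r))); lia.
Qed.

Lemma dense_has_log_cycle E W k :
  {in E, forall e, #|e| = 2} -> W != set0 -> 0 < k ->
  k.+1 * #|W| <= k * #|E ::&: W| ->
  has_cycle_within E (2 * (k * (trunc_log 2 #|W|).+1)).+1.
Proof.
move=> card2E W0 k_gt0 denseW.
exact: dense_has_cycle denseW (ltn_expn_trunc_log _ k_gt0).
Qed.

End ShortCycles.

Lemma leq_card_bigcup (T I : finType) (P : pred I) (F : I -> {set T}) :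
  #|\bigcup_(i | P i) F i| <= \sum_(i | P i) #|F i|.
Proof.
elim/big_rec2: _ => [|i n A _ leAn]; first by rewrite cards0.
by rewrite (leq_trans (leq_card_setU _ _)) // leq_add2l.
Qed.

Lemma leq_card_bigcup_const (T I : finType) (A : {pred I}) (F : I -> {set T}) s :
  {in A, forall i, #|F i| <= s} -> #|\bigcup_(i in A) F i| <= #|A| * s.
Proof.
move=> leFs; apply: leq_trans (leq_card_bigcup _ _) _.
by rewrite -sum_nat_const leq_sum.
Qed.

Lemma maximal_independent_subset (V : finType) (e : rel V) (L : {set V}) d :
  reflexive e -> symmetric e -> {in L, forall x, #|[set y | e x y]| <= d} ->
  exists J : {set V}, [/\ J \subset L, #|L| <= #|J| * d &
    {in J &, forall x y, e x y -> x = y}].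
Proof.
move=> e_refl e_sym degL.
pose independent (J : {set V}) :=
  (J \subset L) && [forall x in J, forall y in J, e x y ==> (x == y)].
have [J /maxsetP[/andP[sJL indepJ] maxJ] _] : {J | maxset independent J & set0 \subset J}.
  by apply: maxset_exists; rewrite /independent sub0set; apply/forall_inP => x; rewrite inE.
have eJ : {in J &, forall x y, e x y -> x = y}.
  move=> x y xJ yJ exy; apply/eqP; move: exy; apply/implyP.
  by move/forall_inP: indepJ => /(_ x xJ)/forall_inP/(_ y yJ).
exists J; split => //.
suff sLJ : L \subset \bigcup_(x in J) [set y | e x y].
  apply: leq_trans (subset_leq_card sLJ) (leq_card_bigcup_const _) => x xJ.
  exact/degL/(subsetP sJL).
apply/subsetP => y yL; apply/negPn/negP => /bigcupP far_y.
have far x : x \in J -> e x y = false.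
  by move=> xJ; apply/negP => exy; apply: far_y; exists x; rewrite // inE.
have yJ : y \in J.
  rewrite -(maxJ (y |: J)) ?setU11 ?subsetUr // /independent subUset sub1set yL sJL /=.
  apply/forall_inP => x /setU1P xJ; apply/forall_inP => z /setU1P zJ; apply/implyP.
  case: xJ zJ => [->|xJ] [->|zJ]; rewrite ?eqxx ?(far x) // 1?e_sym ?far //.
  by rewrite e_sym => /eJ ->.
by have := far y yJ; rewrite e_refl.
Qed.

Section ScatteredSets.
Variables (V I : finType) (A : {set I}) (f : I -> {set V}) (s : nat).
Hypothesis card_f : {in A, forall i, #|f i| <= s}.
Implicit Types (x y : V) (J L : {set V}).

Definition degree x := #|[set i in A | x \in f i]|.

Lemma sum_degree : \sum_x degree x = \sum_(i in A) #|f i|.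
Proof.
transitivity (\sum_x \sum_(i in A) (x \in f i : nat)).
  by apply: eq_bigr => x _; rewrite -big_mkcondr sum1dep_card.
by rewrite exchange_big; apply: eq_bigr => i _; rewrite -big_mkcond sum1_card.
Qed.

Lemma card_large_degree d : d.+1 * #|[set x | d < degree x]| <= #|A| * s.
Proof.
apply: (@leq_trans (\sum_(i in A) #|f i|)); last by rewrite -sum_nat_const leq_sum.
rewrite -sum_degree mulnC -sum_nat_const big_mkcond.
by apply: leq_sum => x _; rewrite inE; case: ifP.
Qed.

Definition meet_common x y := (x == y) || [exists i in A, (x \in f i) && (y \in f i)].

Lemma card_meet_common x : #|[set y | meet_common x y]| <= (degree x * s).+1.
Proof.
apply: leq_trans (_ : #|x |: \bigcup_(i in [set i in A | x \in f i]) f i| <= _).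
  apply/subset_leq_card/subsetP => y; rewrite !inE eq_sym.
  case/orP => [-> //|/exists_inP[i iA /andP[xi yi]]].
  by apply/orP; right; apply/bigcupP; exists i; rewrite // inE iA.
rewrite (leq_trans (leq_card_setU _ _)) // cards1 ltnS leq_card_bigcup_const // => i.
by case/setIdP => /card_f.
Qed.

Lemma scattered_subset L d :
  exists J, [/\ J \subset L, {in A, forall i, #|J :&: f i| <= 1} &
    d.+1 * #|L| <= #|A| * s + d.+1 * (#|J| * (d * s).+1)].
Proof.
pose H := [set x | d < degree x].
have [||x|J [sJL cardJ indepJ]] :=
    @maximal_independent_subset V meet_common (L :\: H) (d * s).+1.
- by move=> x; rewrite /meet_common eqxx.
- move=> x y; rewrite /meet_common eq_sym.
  by under eq_existsb do rewrite [X in _ && X]andbC.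
- rewrite !inE -leqNgt => /andP[deg_x _].
  by apply: leq_trans (card_meet_common x) _; rewrite ltnS leq_mul2r deg_x orbT.
exists J; split; first exact: subset_trans sJL (subsetDl _ _).
  move=> i iA; apply/card_le1_eqP => x y /setIP[xJ xi] /setIP[yJ yi].
  apply: indepJ => //; apply/orP; right.
  by apply/exists_inP; exists i; rewrite ?xi ?yi.
have cardL : #|L| <= #|H| + #|L :\: H|.
  by rewrite -(cardsID H L) leq_add2r subset_leq_card // subsetIr.
apply: leq_trans (leq_mul (leqnn _) cardL) _; rewrite mulnDr.
by apply: leq_add; [exact: card_large_degree | rewrite leq_mul2l].
Qed.

End ScatteredSets.

Definition avoidable (V : finType) (F : {set {set V}}) : Prop :=
  forall x, exists2 e, e \in F & x \notin e.

Section ColorClassTypes.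
Variable V : finType.
Implicit Types (F : {set {set V}}) (J e : {set V}).

Lemma avoidable_matching2 F : is_matching2 F -> avoidable F.
Proof.
case=> e [f [-> _ dis_ef]] x.
have [xe|] := boolP (x \in e); last by exists e; rewrite ?set21.
by exists f; rewrite ?set22 // (disjointFr dis_ef xe).
Qed.

Lemma avoidable_triangle F : is_triangle F -> avoidable F.
Proof.
case=> u [v [w [uniq_uvw ->]]] x.
move: uniq_uvw; rewrite /= !inE negb_or andbT => /andP[/andP[uv uw] vw].
have [->|xu] := eqVneq x u.
  by exists [set v; w]; rewrite !inE ?eqxx ?orbT // negb_or uv.
have [->|xv] := eqVneq x v.
  by exists [set w; u]; rewrite !inE ?eqxx ?orbT // negb_or vw eq_sym.
by exists [set u; v]; rewrite !inE ?eqxx // negb_or xu.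
Qed.

Lemma card_matching2 F : is_matching2 F -> #|F| = 2.
Proof. by case=> e [f [-> neq_ef _]]; rewrite cards2 neq_ef. Qed.

Lemma card_triangle F : is_triangle F -> #|F| <= 3.
Proof.
case=> u [v [w [_ ->]]]; rewrite (leq_trans (leq_card_setU _ _)) // cards1 addn1 ltnS.
by rewrite cards2 ltnS leq_b1.
Qed.

Lemma card_single_edge F : is_single_edge F -> #|F| = 1.
Proof. by case=> e ->; rewrite cards1. Qed.

Lemma card_cover_edges F : {in F, forall e, #|e| = 2} -> #|cover F| <= #|F| * 2.
Proof. by move=> card2F; apply: leq_card_bigcup_const => e /card2F ->. Qed.

Lemma disjoint_cover_edge F J :
  F != set0 -> [disjoint J & cover F] -> exists2 e, e \in F & e \subset ~: J.
Proof.
case/set0Pn=> e eF disJ; exists e; rewrite // -disjoints_subset disjoint_sym.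
exact: disjointWr (bigcup_sup e eF) disJ.
Qed.

Lemma avoidable_edge F J :
  F != set0 -> avoidable F -> #|J :&: cover F| <= 1 ->
  exists2 e, e \in F & e \subset ~: J.
Proof.
move=> F0 avoidF /card_le1_eqP JF1.
have [disJ|] := boolP [disjoint J & cover F]; first exact: disjoint_cover_edge.
case/pred0Pn=> x /andP[/= xJ xF]; have [e eF xe] := avoidF x; exists e => //.
apply/subsetP => y ye; rewrite inE; apply: contra xe => yJ.
have yF : y \in cover F by apply/bigcupP; exists e.
by rewrite (JF1 y x) // inE ?xJ ?yJ.
Qed.

End ColorClassTypes.

Section RainbowCycle.
Variables (V : finType) (G : sgraph V) (c : {set V} -> nat).
Implicit Types (E F : {set {set V}}) (e J : {set V}).

Lemma edges_set2 x y : ([set x; y] \in edges G) = G x y.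
Proof.
apply/imsetP/idP => [[[u v]]|Gxy]; last by exists (x, y); rewrite ?inE.
rewrite inE /= => Guv eq_xy; have Gvu : G v u by rewrite adj_sym.
have := set22 u v; have := set21 u v; rewrite -eq_xy => u_xy v_xy.
have := set22 x y; have := set21 x y; rewrite eq_xy; move: u_xy v_xy.
by do 4![case/set2P => ?; subst].
Qed.

Lemma card_edge e : e \in edges G -> #|e| = 2.
Proof.
case/imsetP => -[x y]; rewrite inE /= => Gxy ->; rewrite cards2.
by case: eqVneq Gxy => // ->; rewrite adj_irr.
Qed.

Lemma color_class_edge F e :
  F \in color_classes G c -> e \in F -> e \in edges G /\ F = color_class G c (c e).
Proof. by case/imsetP => f _ ->; rewrite inE => /andP[eE /eqP <-]. Qed.

Lemma color_class_neq0 F : F \in color_classes G c -> F != set0.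
Proof. by case/imsetP => e eE ->; apply/set0Pn; exists e; rewrite inE eE /=. Qed.

Lemma rainbow_cycle_of_injective E m :
  E \subset edges G -> {in E &, injective c} -> has_cycle_within E m ->
  exists p, [/\ is_cycle G p, rainbow c p & size p <= m].
Proof.
move=> /subsetP sEG injE [p [p3 p_uniq Ep sizep]]; exists p; split => //.
  by split => //; apply: sub_cycle Ep => x y /sEG; rewrite edges_set2.
have sub_cycle_edges : {subset cycle_edges p <= E}.
  by move=> e /imsetP[x xp ->]; apply: next_cycle Ep xp.
exact: sub_in2 injE.
Qed.

Lemma rainbow_representatives (P : pred {set V}) :
  {in color_classes G c, forall F, exists2 e, e \in F & P e} ->
  exists E, [/\ E \subset edges G, {in E, forall e, P e},
    {in E &, injective c} & #|E| = #|color_classes G c|].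
Proof.
move=> exP; pose rep F := odflt set0 [pick e in F | P e].
have repP F : F \in color_classes G c -> rep F \in F /\ P (rep F).
  case/exP=> e eF Pe; rewrite /rep.
  by case: pickP => [e' /andP[]|/(_ e)] //; rewrite eF Pe.
have repK F : F \in color_classes G c -> F = color_class G c (c (rep F)).
  by move=> FC; have [_] := color_class_edge FC (repP _ FC).1.
exists (rep @: color_classes G c); split.
- apply/subsetP => _ /imsetP[F FC ->].
  by have [] := color_class_edge FC (repP _ FC).1.
- by move=> _ /imsetP[F FC ->]; have [] := repP _ FC.
- move=> _ _ /imsetP[F FC ->] /imsetP[F' FC' ->] eq_color.
  by rewrite (repK _ FC) eq_color -repK.
- by rewrite card_in_imset // => F F' /repK {2}-> /repK {2}-> ->.
Qed.

Definition scattering_constant (s m : nat) : nat := 2 * m * (8 * s ^ 2 * m).+1.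

Section AvoidableClasses.
Variables (D : {set {set {set V}}}) (s m : nat).
Hypothesis card_classes : #|color_classes G c| = #|V|.
Hypothesis sub_classes : D \subset color_classes G c.
Hypothesis avoidable_D : {in D, forall F, avoidable F}.
Hypothesis single_classes : {in color_classes G c :\: D, forall F, #|F| = 1}.
Hypothesis card_class : {in color_classes G c, forall F, #|F| <= s}.
Hypothesis many_avoidable : m.+1 * #|V| <= 2 * m * #|D|.

Lemma card_cover_class F : F \in color_classes G c -> #|cover F| <= #|F| * 2.
Proof.
move=> FC; apply: card_cover_edges => e /(color_class_edge FC)[eE _].
exact: card_edge.
Qed.

Lemma scattered_free_set :
  exists J, [/\ #|V| <= scattering_constant s m * #|J|,
    {in color_classes G c :\: D, forall F, [disjoint J & cover F]} &
    {in color_classes G c, forall F, #|J :&: cover F| <= 1}].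
Proof.
pose C := color_classes G c.
pose X := \bigcup_(F in C :\: D) cover F.
have card_single : #|C :\: D| + #|D| = #|V|.
  by rewrite -card_classes -(cardsID D C) (setIidPr sub_classes) addnC.
have cardX : #|X| <= #|C :\: D| * 2.
  apply: leq_card_bigcup_const => F FS; have [FC _] := setDP FS.
  by apply: leq_trans (card_cover_class FC) _; rewrite single_classes.
have card_cover F : F \in C -> #|cover F| <= s * 2.
  by move=> FC; rewrite (leq_trans (card_cover_class FC)) // leq_mul2r card_class.
have cardV : #|V| = #|X| + #|~: X| by rewrite cardsC.
have many_free : #|V| <= m * #|~: X| by nia.
(* At most [#|V| / 2m] vertices have degree above [4sm], half as many as the lower
   bound that [many_free] gives for [~: X]. *)
have [J [sJX JC cardJ]] := scattered_subset card_cover (~: X) (4 * s * m).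
exists J; split => // [|F FS]; last first.
  by apply: disjointWr (bigcup_sup F FS) _; rewrite disjoints_subset.
rewrite /scattering_constant -(leq_pmul2l (ltn0Sn (4 * s * m))).
have := leq_mul (leqnn m) cardJ; rewrite card_classes.
rewrite (_ : 4 * s * m * (s * 2) = 8 * s ^ 2 * m); last by lia.
have := leq_mul (leqnn (4 * s * m).+1) many_free.
move: #|V| #|~: X| #|J| (8 * s ^ 2 * m).+1 => n l j K.
clear; nia.
Qed.

Lemma short_rainbow_cycle : 1 < #|V| -> 0 < m ->
  exists p, [/\ is_cycle G p, rainbow c p &
    size p <= (4 * scattering_constant s m + 1) * trunc_log 2 #|V|].
Proof.
move=> V_gt1 m_gt0; have [J [cardJ freeJ scatteredJ]] := scattered_free_set.
have k_gt0 : 0 < scattering_constant s m by rewrite !muln_gt0 m_gt0.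
move: (scattering_constant s m) k_gt0 cardJ => k k_gt0 cardJ.
have [F FC|E [sEG sEJ injE cardE]] := @rainbow_representatives (fun e => e \subset ~: J).
  have F0 := color_class_neq0 FC; have [FD|FD] := boolP (F \in D).
    exact: avoidable_edge F0 (avoidable_D FD) (scatteredJ F FC).
  by apply: disjoint_cover_edge F0 (freeJ _ _); rewrite inE FD.
have card2E : {in E, forall e, #|e| = 2}.
  by move=> e /(subsetP sEG)/card_edge.
have EJ : E ::&: ~: J = E.
  by apply/setP => e; rewrite inE andb_idr // => /sEJ.
have J0 : ~: J != set0.
  have /card_gt0P[e eE] : 0 < #|E| by rewrite cardE card_classes ltnW.
  have /card_gt0P[x xe] : 0 < #|e| by rewrite card2E.
  by apply/set0Pn; exists x; apply: (subsetP (sEJ e eE)).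
have dense : k.+1 * #|~: J| <= k * #|E ::&: ~: J|.
  by rewrite EJ cardE card_classes; have := cardsC J; lia.
apply: rainbow_cycle_of_injective sEG injE _.
apply: has_cycle_within_leq (dense_has_log_cycle card2E J0 k_gt0 dense).
have log_gt0 : 0 < trunc_log 2 #|V| by rewrite trunc_log_gt0.
have log_le : trunc_log 2 #|~: J| <= trunc_log 2 #|V| by rewrite leq_trunc_log // max_card.
nia.
Qed.

End AvoidableClasses.
End RainbowCycle.

Local Open Scope ring_scope.

Lemma trunc_log_le_log2 (R : realType) (n : nat) : (0 < n)%N ->
  (trunc_log 2 n)%:R <= log2 n%:R :> R.
Proof.
move=> n_gt0; have ln2_gt0 : 0 < ln 2 :> R by rewrite ln_gt0 // ltr1n.
rewrite /log2 ler_pdivlMr // mulr_natl -lnXn ?ltr0n // ler_ln ?posrE ?exprn_gt0 ?ltr0n //.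
by rewrite -natrX ler_nat trunc_logP.
Qed.

Lemma gt_half_nat_density (R : archiRealFieldType) (alpha : R) : 1 / 2 < alpha ->
  exists2 m : nat, (0 < m)%N & forall n d : nat,
    alpha * n%:R <= d%:R -> (m.+1 * n <= 2 * m * d)%N.
Proof.
move=> alpha_gt; pose excess := 2 * alpha - 1; pose m := Num.bound excess^-1.
have excess_gt0 : 0 < excess by rewrite /excess; lra.
have m_excess : 1 < m%:R * excess.
  by rewrite -ltr_pdivrMr // mul1r archi_boundP // invr_ge0 ltW.
exists m => [|n d le_d].
  by rewrite lt0n; apply: contraTneq m_excess => ->; rewrite mul0r ltr10.
rewrite -(ler_nat R) !natrM -natr1.
apply: (@le_trans _ _ (2 * m%:R * (alpha * n%:R))); last by rewrite ler_wpM2l // mulr_ge0.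
by rewrite mulrA ler_wpM2r //; move: m_excess; rewrite /excess; lra.
Qed.

Theorem theorem3p1 (R : realType) (alpha : R) (halpha : 1 / 2 < alpha) :
  exists (N0 : nat) (C : R),
  forall (V : finType) (G : sgraph V) (c : {set V} -> nat)
         (FM FT FS : {set {set {set V}}}),
    (N0 <= #|V|)%N ->
    #|color_classes G c| = #|V| ->
    color_classes G c = FM :|: FT :|: FS ->
    (forall F, F \in FM -> is_matching2 F) ->
    (forall F, F \in FT -> is_triangle F) ->
    (forall F, F \in FS -> is_single_edge F) ->
    alpha * #|V|%:R <= #|FM :|: FT|%:R ->
    exists p : seq V,
      [/\ is_cycle G p, rainbow c p & (size p)%:R <= C * log2 #|V|%:R].
Proof.
have [m m_gt0 density] := gt_half_nat_density halpha.
exists 2%N, (4 * scattering_constant 3 m + 1)%:R.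
move=> V G c FM FT FS V_gt1 card_classes def_classes matchingM triangleT singleS le_alpha.
have [|F|F|F||//|//|p [p_cycle p_rainbow size_p]] :=
    @short_rainbow_cycle V G c (FM :|: FT) 3 m card_classes.
- by rewrite def_classes subsetUl.
- by case/setUP => [/matchingM/avoidable_matching2|/triangleT/avoidable_triangle].
- by rewrite def_classes setDUl setDv set0U => /setDP[/singleS/card_single_edge].
- rewrite def_classes => /setUP[/setUP[/matchingM/card_matching2->|]|] //.
    by move/triangleT/card_triangle.
  by move/singleS/card_single_edge->.
- exact: density.
exists p; split => //.
apply: le_trans (ler_wpM2l (ler0n _ _) (trunc_log_le_log2 R (ltnW V_gt1))).
by rewrite -natrM ler_nat.
Qed.
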